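(* Let $1\le p<\infty$, let $(X,\rho)$ be a semi-normed space and let $f\in\mathcal{U}^p_\rho([a,b];X)$. Then for every real number $c>0$, $$m^*\big(\{x\in[a,b]:\rho(f(x))\ge c\}\big)\le\frac{1}{c^p}\,\|f\|_{\mathcal{U}^p_\rho}^p .$$
   Context: $[a,b]$ is a compact interval and $(X,\rho)$ is a real vector space with a semi-norm $\rho$; $m^*$ denotes Lebesgue outer measure. A gauge on $[a,b]$ is a function $\delta:[a,b]\to(0,\infty)$. A tagged partition of $[a,b]$ is a finite collection $D=\{([u_i,v_i],t_i):1\le i\le n\}$ of non-overlapping non-degenerate closed intervals with union $[a,b]$ and tags $t_i\in[u_i,v_i]$; it is $\delta$-fine if $[u_i,v_i]\subseteq(t_i-\delta(t_i),t_i+\delta(t_i))$ for every $i$. For such $D$, $(D)\sum\varphi(t)(v-u)$ denotes $\sum_{i=1}^n\varphi(t_i)(v_i-u_i)$. For $f:[a,b]\to X$ and $1\le p<\infty$, $$\mu^p_\rho(f,[a,b])=\inf_{\text{gauge }\delta}\ \sup\Big\{(D)\sum \rho(f(t))^p\,(v-u): D\text{ is a }\delta\text{-fine tagged partition of }[a,b]\Big\}\in[0,\infty],$$ $\|f\|_{\mathcal{U}^p_\rho}=\mu^p_\rho(f,[a,b])^{1/p}$, and $\mathcal{U}^p_\rho([a,b];X)$ is the set of all $f:[a,b]\to X$ with $\mu^p_\rho(f,[a,b])<\infty$. *)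

(* Defs.v *)
From HB Require Import structures.
From mathcomp Require Import all_boot all_order all_algebra.
From mathcomp Require Import all_classical all_reals all_analysis.
Set Implicit Arguments.
Unset Strict Implicit.
Unset Printing Implicit Defensive.
Import Order.TTheory GRing.Theory Num.Theory.
Import numFieldNormedType.Exports.
Local Open Scope classical_set_scope.
Local Open Scope ring_scope.

(* Functions on the compact interval [a, b] (gauges, integrands) are
   represented by total functions on R. Tags belong to [a, b], so the values
   outside [a, b] are never used. *)

Definition is_seminorm (R : realType) (X : lmodType R) (rho : X -> R) : Prop :=
  [/\ forall x, 0 <= rho x,
      forall (k : R) x, rho (k *: x) = `|k| * rho x &
      forall x y, rho (x + y) <= rho x + rho y].

Definition is_gauge (R : realType) (a b : R) (delta : R -> R) : Prop :=
  forall x, x \in `[a, b] -> 0 < delta x.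

(* Intervals are non-overlapping when their interiors are disjoint. *)
Record tagged_partition (R : realType) (a b : R) := TaggedPartition {
  tp_size : nat;
  tp_left : 'I_tp_size -> R;
  tp_right : 'I_tp_size -> R;
  tp_tag : 'I_tp_size -> R;
  tp_nondegenerate : forall i, tp_left i < tp_right i;
  tp_nonoverlapping : trivIset [set: 'I_tp_size]
    (fun i => `]tp_left i, tp_right i[%classic);
  tp_cover : \bigcup_i `[tp_left i, tp_right i]%classic = `[a, b]%classic;
  tp_tag_in : forall i, tp_tag i \in `[tp_left i, tp_right i]
}.

Section RiemannSums.
Context (R : realType) (a b : R).
Implicit Types (D : tagged_partition a b) (delta phi : R -> R).

Definition fine_for delta D : Prop := forall i : 'I_(tp_size D),
  `[tp_left i, tp_right i]%classic `<=`
    `]tp_tag i - delta (tp_tag i), tp_tag i + delta (tp_tag i)[%classic.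

Definition riemann_sum D phi : R :=
  \sum_(i < tp_size D) phi (tp_tag i) * (tp_right i - tp_left i).

End RiemannSums.

Section GaugeSpaces.
Context (R : realType) (X : lmodType R) (rho : X -> R) (p a b : R).
Local Open Scope ereal_scope.

(* By Cousin's lemma the supremum is over a nonempty set when a < b; it is
   then nonnegative, and so is the infimum. *)
Definition gauge_mu (f : R -> X) : \bar R :=
  ereal_inf [set ereal_sup
    [set (riemann_sum D (fun t => (rho (f t) `^ p)%R))%:E
      | D in [set D : tagged_partition a b | fine_for delta D]]
    | delta in [set delta : R -> R | is_gauge a b delta]].

Definition gauge_norm (f : R -> X) : \bar R := gauge_mu f `^ (p^-1)%R.

Definition gauge_space : set (R -> X) := [set f | gauge_mu f < +oo].

End GaugeSpaces.

(* The outer measure from which the library's Lebesgue measure is constructed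
   by extension; on an arbitrary set it is the infimum of the
   total lengths of its countable covers by intervals ]u, v]. *)
Definition lebesgue_outer_measure (R : realType) (A : set R) : \bar R :=
  ((@wlength R idfun)^*)%mu A.

(* Main.v *)
(* Fix a gauge delta, let S be the supremum of its fine Riemann sums of
   rho(f)^p, and let E_n be the set of the x in [a, b] with rho(f x) >= c and
   delta x > 1/n.  By a Cousin argument there is a delta-fine partition whose
   cells meeting E_n are short and tagged in E_n; the union G_n of these cells
   contains E_n and satisfies c^p m(G_n) <= S.  The E_n increase to the set to
   be measured, which is therefore contained in the increasing union over n of the
   intersections of the G_k, k >= n, and that union has measure at most
   S / c^p. *)

Require Import Defs.
From HB Require Import structures.
From mathcomp Require Import all_boot all_order all_algebra.
From mathcomp Require Import all_classical all_reals all_analysis.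
From mathcomp Require Import lra.
Import Order.TTheory GRing.Theory Num.Theory.
Import numFieldNormedType.Exports.
Local Open Scope classical_set_scope.
Local Open Scope ring_scope.

(** Cousin's lemma as an induction principle: the points reachable from [a] have a supremum, and the
    local hypothesis there pushes the reach on to [b]. An arbitrary [Q] lets extra data travel along
    with a fine partition. *)
Lemma cousin_ind (R : realType) (Q : R -> R -> Prop) (a b : R) :
  a < b ->
  (forall u v w, u < v -> v < w -> Q u v -> Q v w -> Q u w) ->
  (forall x, x \in `[a, b] -> exists2 e, 0 < e &
    forall u v, u < v -> x \in `[u, v] -> x - e < u -> v < x + e -> Q u v) ->
  Q a b.
Proof.
move=> ab Qtrans Qloc.
(* The disjunct [x = a] makes [S] nonempty, as [Q] is only available on nondegenerate intervals. *)
pose S := [set x | x \in `[a, b] /\ (x = a \/ Q a x)].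
have Sa : S a by split; [rewrite in_itv/=; lra|left].
have Sb : ubound S b by move=> x [/[!in_itv]/= /andP[]].
have hS : has_sup S by split; [exists a|exists b].
have a_sup : a <= sup S by apply: ub_le_sup => //; exists b.
have sb : sup S <= b by apply: ge_sup => //; exists a.
have sab : sup S \in `[a, b] by rewrite in_itv/= a_sup.
have [e e0 Qe] := Qloc _ sab.
have [y [yab Qy] sy] := sup_adherent e0 hS.
have ys : y <= sup S by apply: ub_le_sup; [exists b|].
(* A point past the supremum, capped at [b]; since [y] and [z] are both within [e] of [sup S], the
   local hypothesis joins them. *)
pose z := Num.min b (sup S + e / 2).
have zb : z <= b by rewrite ge_min lexx.
have zse : z <= sup S + e / 2 by rewrite ge_min lexx orbT.
have sz : sup S <= z by rewrite le_min sb/=; lra.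
have Sz : S z.
  have [<-//|yz] := eqVneq y z.
  have {}yz : y < z by rewrite lt_neqAle yz/=; lra.
  have Qyz : Q y z by apply: Qe => //; [rewrite in_itv/=|]; lra.
  move: yab; rewrite in_itv/= => /andP[ay yb].
  split; first by rewrite in_itv/=; lra.
  right; have [ya|ya] := eqVneq y a; first by rewrite -ya.
  case: Qy => [/eqP|Qay]; first by rewrite (negbTE ya).
  by apply: (Qtrans _ y) => //; rewrite lt_neqAle eq_sym ya.
have zs : z <= sup S by apply: ub_le_sup; [exists b|].
(* Without the cap, [z] would be a point of [S] beyond [sup S]. *)
have bz : b = z.
  have [bs|sb'] := leP b (sup S + e / 2); first by rewrite /z (min_idPl bs).
  by move: zs; rewrite /z (min_idPr (ltW sb')); lra.
by case: Sz => _; rewrite -bz => -[ba|//]; move: ab; rewrite ba ltxx.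
Qed.

Section partitions.
Context {R : realType}.
Implicit Types u v w : R.

Program Definition tp_single {u v t} (uv : u < v) (tuv : t \in `[u, v]) :
    tagged_partition u v :=
  @TaggedPartition R u v 1 (fun=> u) (fun=> v) (fun=> t) (fun=> uv) _ _
    (fun=> tuv).
Next Obligation.
by move=> *; apply/trivIsetP => i j _ _; rewrite (ord1 i) (ord1 j) eqxx.
Qed.
Next Obligation. by move=> *; apply: bigcup_const; exists ord0. Qed.

Lemma tp_sub {u v} (D : tagged_partition u v) (i : 'I_(tp_size D)) :
  `[tp_left i, tp_right i] `<=` `[u, v].
Proof. by rewrite -(tp_cover D) => x xi; exists i. Qed.

Lemma tp_bounds {u v} (D : tagged_partition u v) (i : 'I_(tp_size D)) :
  u <= tp_left i /\ tp_right i <= v.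
Proof.
have lr := ltW (tp_nondegenerate i).
split.
- by have := @tp_sub u v D i (tp_left i); rewrite /= !in_itv/= lexx lr
    => /(_ isT)/andP[].
- by have := @tp_sub u v D i (tp_right i); rewrite /= !in_itv/= lexx lr
    => /(_ isT)/andP[].
Qed.

(** Serves left ends, right ends and tags alike in [tp_cat], so that one pair of rewriting rules
    handles all three. *)
Definition glue {m n T} (F : 'I_m -> T) (G : 'I_n -> T) (i : 'I_(m + n)) : T :=
  match fintype.split i with inl j => F j | inr k => G k end.

Lemma glue_lshift {m n T} (F : 'I_m -> T) (G : 'I_n -> T) i :
  glue F G (lshift n i) = F i.
Proof. by rewrite /glue (unsplitK (inl i)). Qed.

Lemma glue_rshift {m n T} (F : 'I_m -> T) (G : 'I_n -> T) i :
  glue F G (rshift m i) = G i.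
Proof. by rewrite /glue (unsplitK (inr i)). Qed.

Definition glueE := (@glue_lshift, @glue_rshift).

Program Definition tp_cat {u v w} (uv : u < v) (vw : v < w)
    (D : tagged_partition u v) (D' : tagged_partition v w) :
    tagged_partition u w :=
  @TaggedPartition R u w (tp_size D + tp_size D')
    (glue (@tp_left _ _ _ D) (@tp_left _ _ _ D'))
    (glue (@tp_right _ _ _ D) (@tp_right _ _ _ D'))
    (glue (@tp_tag _ _ _ D) (@tp_tag _ _ _ D')) _ _ _ _.
Next Obligation.
move=> u v w uv vw D D' i.
by case: (split_ordP i) => j ->; rewrite !glueE tp_nondegenerate.
Qed.
Next Obligation.
move=> u v w uv vw D D'.
(* The point [v] separates the cells of [D] from those of [D']. *)
have cross (i : 'I_(tp_size D)) (j : 'I_(tp_size D')) :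
    `]tp_left i, tp_right i[ `&` `]tp_left j, tp_right j[ = set0 :> set R.
  apply/seteqP; split => // x [] /=; rewrite !in_itv/=.
  have [_ ?] := tp_bounds D i; have [? _] := tp_bounds D' j; lra.
have /trivIsetP tD := @tp_nonoverlapping _ _ _ D.
have /trivIsetP tD' := @tp_nonoverlapping _ _ _ D'.
apply/trivIsetP => i j _ _.
case: (split_ordP i) => k ->; case: (split_ordP j) => l ->; rewrite !glueE.
- by rewrite (inj_eq (@lshift_inj _ _)); exact: tD.
- by move=> _; exact: cross.
- by move=> _; rewrite setIC; exact: cross.
- by rewrite (inj_eq (@rshift_inj _ _)); exact: tD'.
Qed.
Next Obligation.
move=> u v w uv vw D D'.
apply/seteqP; split => [x [i _]|x].
- case: (split_ordP i) => k ->; rewrite !glueE => /tp_sub/=; rewrite !in_itv/=;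
  lra.
- rewrite /= in_itv/= => /andP[ux xw].
  have [xv|vx] := leP x v.
  + have : `[u, v]%classic x by rewrite /= in_itv/= ux.
    by rewrite -(tp_cover D) => -[i _ ?]; exists (lshift _ i); rewrite ?glueE.
  + have : `[v, w]%classic x by rewrite /= in_itv/= ltW.
    by rewrite -(tp_cover D') => -[i _ ?]; exists (rshift _ i); rewrite ?glueE.
Qed.
Next Obligation.
move=> u v w uv vw D D' i.
by case: (split_ordP i) => j ->; rewrite !glueE tp_tag_in.
Qed.

Lemma fine_cat {u v w} (uv : u < v) (vw : v < w) (D : tagged_partition u v)
    (D' : tagged_partition v w) delta :
  fine_for delta D -> fine_for delta D' -> fine_for delta (tp_cat uv vw D D').
Proof.
by move=> fD fD' i; rewrite /=; case: (split_ordP i) => j ->; rewrite !glueE.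
Qed.

Lemma riemann_sum_cat {u v w} (uv : u < v) (vw : v < w)
    (D : tagged_partition u v) (D' : tagged_partition v w) phi :
  riemann_sum (tp_cat uv vw D D') phi = riemann_sum D phi + riemann_sum D' phi.
Proof.
rewrite /riemann_sum /= big_split_ord/=.
by congr (_ + _); apply: eq_bigr => i _; rewrite !glueE.
Qed.

Lemma riemann_sum_single u v t (uv : u < v) (tuv : t \in `[u, v]) phi :
  riemann_sum (tp_single uv tuv) phi = phi t * (v - u).
Proof. by rewrite /riemann_sum big_ord1. Qed.

Lemma fine_single u v t (uv : u < v) (tuv : t \in `[u, v]) (delta : R -> R) :
  t - delta t < u -> v < t + delta t -> fine_for delta (tp_single uv tuv).
Proof. by move=> tu vt i x /=; rewrite !in_itv/=; lra. Qed.

End partitions.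

Section chebyshev.
Context {R : realType}.
Implicit Types (a b k e : R) (phi delta : R -> R).
Local Notation mu := (@lebesgue_measure R).

(* A cell shorter than [e] that meets [A] is tagged by a point of [A], which
   keeps it fine; the union [G] of these cells covers [A]. *)
Lemma fine_partition_hull {a b phi delta k e} (A : set R) :
  a < b -> 0 <= k -> (forall x, 0 <= phi x) -> is_gauge a b delta -> 0 < e ->
  (forall x, A x -> e < delta x /\ k <= phi x) ->
  exists (D : tagged_partition a b) (G : set R),
    [/\ fine_for delta D, measurable G, A `&` `[a, b] `<=` G
      & (k%:E * mu G <= (riemann_sum D phi)%:E)%E].
Proof.
move=> ab k0 phi0 gd e0 HA.
pose Q u v := exists (D : tagged_partition u v) (G : set R),
    [/\ fine_for delta D, measurable G, A `&` `[u, v] `<=` G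
      & (k%:E * mu G <= (riemann_sum D phi)%:E)%E].
apply: (@cousin_ind R Q) => // [u v w uv vw [D [G [fD mG AG kG]]]
    [D' [G' [fD' mG' AG' kG']]]|x xab].
- exists (tp_cat uv vw D D'), (G `|` G'); split.
  + exact: fine_cat.
  + exact: measurableU.
  + move=> x [Ax /=]; rewrite in_itv/= => /andP[ux xw].
    have [xv|vx] := leP x v.
    * by left; apply: AG; split => //=; rewrite in_itv/= ux.
    * by right; apply: AG'; split => //=; rewrite in_itv/= ltW.
  (* Riemann sums add up, while [mu] is subadditive on [G] and [G']. *)
  + rewrite riemann_sum_cat EFinD (le_trans _ (leeD kG kG'))//.
    by rewrite -ge0_muleDr// lee_wpmul2l// measureU2.
(* The bound [delta x] makes the cell fine for the tag [x]; [e / 2] on each side makes it shorter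
   than [e], hence fine for any tag in [A], where [delta] exceeds [e]. *)
- exists (Num.min (delta x) (e / 2)).
    by rewrite lt_min gd//=; lra.
  move=> u v uv xuv.
  rewrite ltrBlDr -ltrBlDl lt_min => /andP[xud xue].
  rewrite -ltrBlDl lt_min => /andP[vxd vxe].
  have [[t [At tuv]]|At] := pselect (A `&` `[u, v] !=set0).
  + have [et kt] := HA _ At.
    exists (tp_single uv tuv), `[u, v]%classic; split => //.
    * have := tuv; rewrite /= in_itv/= => ?.
      by apply: fine_single; lra.
    * rewrite riemann_sum_single lebesgue_measure_itv/= lte_fin uv.
      by rewrite -EFinB -EFinM lee_fin ler_wpM2r// subr_ge0 ltW.
  (* A cell missing [A] keeps the tag [x]; its term is nonnegative and nothing has to be covered. *)
  + exists (tp_single uv xuv), set0; split => //.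
    * by apply: fine_single; lra.
    * by move=> y Ay; apply: At; exists y.
    * rewrite measure0 mule0 riemann_sum_single lee_fin mulr_ge0//.
      by rewrite subr_ge0 ltW.
Qed.

(** The [G n] need not increase, but their tail intersections [H n] do, and these still contain
    [E n] because the [E n] increase. Continuity from below is applied to the measurable [H n], as
    the [E n] may fail to be measurable. *)
Lemma outer_measure_bound_liminf (E G : nat -> set R) (K : \bar R) :
  (forall n m, (n <= m)%N -> E n `<=` E m) ->
  (forall n, E n `<=` G n) -> (forall n, measurable (G n)) ->
  (forall n, mu (G n) <= K)%E ->
  (lebesgue_outer_measure (\bigcup_n E n) <= K)%E.
Proof.
move=> Emono EG mG GK.
pose H n := \bigcap_(m in [set m | (n <= m)%N]) G m.
have mH n : measurable (H n) by apply: bigcap_measurable => //; exists n => /=.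
have mUH : measurable (\bigcup_n H n) by exact: bigcup_measurable.
have HK n : (mu (H n) <= K)%E.
  apply: (le_trans _ (GK n)); apply: le_measure.
  - exact: mem_set (mH n).
  - exact: mem_set (mG n).
  - by move=> x; apply => /=.
have cH : (mu \o H) x @[x --> \oo] --> mu (\bigcup_n H n).
  apply: nondecreasing_cvg_mu => // n m nm; apply/subsetPset.
  by move=> x Hx i /(leq_trans nm); exact: Hx.
apply: (@le_trans _ _ (mu (\bigcup_n H n))).
  (* [mu] is by construction the outer measure restricted to measurable sets, so monotonicity of the
     latter applies. *)
  apply: le_outer_measure; apply: subset_bigcup => n _ x Ex m nm.
  by apply: EG; exact: Emono Ex.
rewrite -(cvg_lim _ cH)//; apply: lime_le.
  by apply/cvg_ex; eexists; exact: cH.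
by apply: nearW => n; exact: HK.
Qed.

(** The right-hand side is [gauge_mu] unfolded, with a general nonnegative integrand [phi]; it
    suffices to bound the supremum for each gauge. *)
Lemma gauge_chebyshev {a b phi k} : a < b -> 0 < k -> (forall x, 0 <= phi x) ->
  (k%:E * lebesgue_outer_measure [set x | x \in `[a, b] /\ (k <= phi x)%R]
     <= ereal_inf [set ereal_sup
    [set (riemann_sum D phi)%:E
      | D in [set D : tagged_partition a b | fine_for delta D]]
    | delta in [set delta : R -> R | is_gauge a b delta]])%E.
Proof.
move=> ab k0 phi0.
apply/ereal_infP => _ [delta /= gd <-].
set S := ereal_sup _.
(* The lower bound on [delta] plays the role of [e] in [fine_partition_hull]. *)
pose E n := [set x | x \in `[a, b] /\ n.+1%:R^-1 < delta x /\ (k <= phi x)%R].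
have hull n : exists G,
    [/\ measurable G, E n `<=` G & (mu G <= (k^-1)%:E * S)%E].
  have Ed x : E n x -> n.+1%:R^-1 < delta x /\ k <= phi x by case.
  have n0 : 0 < n.+1%:R^-1 :> R by rewrite invr_gt0.
  have [D [G [fD mG EG kG]]] :=
    fine_partition_hull (E n) ab (ltW k0) phi0 gd n0 Ed.
  exists G; split => //.
  - by move=> x Ex; apply: EG; split => //; case: Ex.
  - rewrite lee_pdivlMl//; apply: (le_trans kG).
    by apply: ereal_sup_ubound; exists D.
have [G HG] := choice hull.
rewrite -lee_pdivlMl//.
have -> : [set x | x \in `[a, b] /\ (k <= phi x)%R] = \bigcup_n E n.
  apply/seteqP; split => [x [xab kx]|x [n _ [xab [_ kx]]]]; last by [].
  (* Archimedean property: the positive number [delta x] exceeds some [n.+1%:R^-1]. *)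
  have [n nx] := ltr_add_invr (gd _ xab).
  by exists n => //; split => //; split => //; rewrite add0r in nx.
apply: (@outer_measure_bound_liminf E G) => [n m nm x [xab [xd kx]]|n|n|n].
- split => //; split => //; apply: le_lt_trans xd.
  by rewrite lef_pV2 ?posrE// ler_nat.
- by case: (HG n).
- by case: (HG n).
- by case: (HG n).
Qed.

End chebyshev.

Theorem theorem8 (R : realType) (a b : R) (hab : a < b) (p : R) (hp : 1 <= p)
    (X : lmodType R) (rho : X -> R) (hrho : is_seminorm rho)
    (f : R -> X) (hf : gauge_space rho p a b f) (c : R) (hc : 0 < c) :
  (lebesgue_outer_measure [set x | x \in `[a, b] /\ (c <= rho (f x))%R]
     <= ((c `^ p)^-1)%:E * (gauge_norm rho p a b f `^ p))%E.
Proof.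
have [rho0 _ _] := hrho.
have p0 : 0 < p by lra.
have cp0 : 0 < c `^ p by exact: powR_gt0.
have H := gauge_chebyshev hab cp0 (fun t => powR_ge0 (rho (f t)) p).
rewrite -/(gauge_mu rho p a b f) in H.
(* Read off from the inequality just obtained; it lets the [p]-th power cancel the [p]-th root. *)
have mu0 : (0 <= gauge_mu rho p a b f)%E.
  apply: (le_trans _ H); apply: mule_ge0; first by rewrite lee_fin ltW.
  exact: outer_measure_ge0.
rewrite /gauge_norm -poweRrM mulVf ?gt_eqF// poweRe1// lee_pdivlMl//.
apply: (le_trans _ H); apply: lee_wpmul2l; first by rewrite lee_fin ltW.
apply: le_outer_measure => x [xab cx]; split => //.
by apply: ge0_ler_powR => //; rewrite ?nnegrE//; lra.
Qed.
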